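(* Let $q,a,b$ be nonzero complex numbers with $|q|<1$ and $\max\{|ab|,|aq^2|,|bq^2|\}<1$. Then $$\frac{(q^2,ab;q^2)_\infty}{(aq^2,bq^2;q^2)_\infty}\;{}_3\phi_2\left(\begin{matrix}q^2/a,\,q^2/b,\,q^2\\ q^3,\,q^3\end{matrix};q^2,ab\right)=(1-q)^2\sum_{n=0}^{\infty}\frac{1+q^{2n+1}}{1-q^{2n+1}}\,\frac{(q^2/a,q^2/b;q^2)_n}{(aq^2,bq^2;q^2)_n}(-ab)^nq^{n^2+n}.$$
   Context: Notation, for a base $p$ with $|p|<1$: $(x;p)_0=1$, $(x;p)_n=\prod_{k=0}^{n-1}(1-xp^k)$, $(x;p)_\infty=\prod_{k=0}^\infty(1-xp^k)$, $(x_1,\dots,x_k;p)_n=(x_1;p)_n\cdots(x_k;p)_n$ (also for $n=\infty$), and $${}_3\phi_2\left(\begin{matrix}A_1,A_2,A_3\\ B_1,B_2\end{matrix};p,z\right)=\sum_{n=0}^\infty\frac{(A_1,A_2,A_3;p)_n}{(p,B_1,B_2;p)_n}z^n .$$ *)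

(* Defs.v *)
From Stdlib Require Import Reals Lra Lia.
From Coquelicot Require Import Coquelicot.
Local Open Scope C_scope.

(* [lim] is total: these are the expected values only when the limit exists;
   see [Clim_seq_unique]. *)
Definition Clim_seq (u : nat -> C) : C :=
  @lim C_CompleteNormedModule (filtermap u eventually).

Definition CSeries (u : nat -> C) : C :=
  Clim_seq (@sum_n C_AbelianGroup u).

Definition ex_Cseries (u : nat -> C) : Prop :=
  @ex_series C_AbsRing C_NormedModule u.

Fixpoint qpoch (x p : C) (n : nat) : C :=
  match n with
  | O => 1
  | S m => qpoch x p m * (1 - x * p ^ m)
  end.

Definition qpoch_inf (x p : C) : C := Clim_seq (qpoch x p).

Definition phi32_term (A1 A2 A3 B1 B2 p z : C) (n : nat) : C :=
  (qpoch A1 p n * qpoch A2 p n * qpoch A3 p n)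
  / (qpoch p p n * qpoch B1 p n * qpoch B2 p n) * z ^ n.

Definition phi32 (A1 A2 A3 B1 B2 p z : C) : C :=
  CSeries (phi32_term A1 A2 A3 B1 B2 p z).

Lemma Clim_seq_unique (u : nat -> C) (l : C) :
  filterlim u eventually (@locally C_NormedModule l) -> Clim_seq u = l.
Proof.
intros H.
assert (PF : ProperFilter (filtermap u eventually))
  by (apply filtermap_proper_filter; apply eventually_filter).
apply (@filterlim_locally_unique nat C_AbsRing C_NormedModule eventually _ u);
  [|exact H].
apply filterlim_locally; intros eps.
apply (@complete_cauchy C_CompleteNormedModule (filtermap u eventually) PF).
intros e; exists l.
exact (proj1 (filterlim_locally (U := C_NormedModule) u l) H e).
Qed.

Lemma CSeries_unique (u : nat -> C) (l : C) :
  @is_series C_AbsRing C_NormedModule u l -> CSeries u = l.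
Proof. exact (Clim_seq_unique _ l). Qed.

Lemma qpoch_bound (x p : C) (n : nat) :
  (Cmod p < 1)%R ->
  (Cmod (qpoch x p n) <= exp (Cmod x / (1 - Cmod p)))%R.
Proof.
intros Hp.
assert (Hx := Cmod_ge_0 x); assert (Hp0 := Cmod_ge_0 p).
assert (H : (Cmod (qpoch x p n)
             <= exp (Cmod x * ((1 - Cmod p ^ n) / (1 - Cmod p))))%R).
{ induction n as [|n IH].
  - simpl. rewrite Cmod_1.
    replace (Cmod x * ((1 - 1) / (1 - Cmod p)))%R with 0%R by (field; lra).
    rewrite exp_0; lra.
  - simpl qpoch. rewrite Cmod_mult.
    replace (Cmod x * ((1 - Cmod p ^ S n) / (1 - Cmod p)))%R
      with (Cmod x * ((1 - Cmod p ^ n) / (1 - Cmod p)) + Cmod x * Cmod p ^ n)%R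
      by (simpl; field; lra).
    rewrite exp_plus.
    apply Rmult_le_compat; try apply Cmod_ge_0; [exact IH|].
    eapply Rle_trans; [|apply exp_ineq1_le].
    unfold Cminus. eapply Rle_trans; [apply Cmod_triangle|].
    rewrite Cmod_1, Cmod_opp, Cmod_mult, Cmod_pow. lra. }
eapply Rle_trans; [exact H|].
assert (exp_mono : forall u v : R, (u <= v)%R -> (exp u <= exp v)%R).
{ intros u v [Huv|Huv]; [left; now apply exp_increasing|rewrite Huv; lra]. }
apply exp_mono. apply Rmult_le_compat_l; [exact Hx|].
rewrite <- (Rmult_1_l (/ (1 - Cmod p))). unfold Rdiv.
apply Rmult_le_compat_r; [left; apply Rinv_0_lt_compat; lra|].
assert (0 <= Cmod p ^ n)%R by (apply pow_le; exact Hp0). lra.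
Qed.

Lemma qpoch_inf_correct (x p : C) :
  (Cmod p < 1)%R ->
  filterlim (qpoch x p) eventually (@locally C_NormedModule (qpoch_inf x p)).
Proof.
intros Hp.
set (d := fun n => match n with
                   | O => RtoC 1
                   | S m => qpoch x p m * (- (x * p ^ m))
                   end).
assert (Hsum : forall n, @sum_n C_AbelianGroup d n = qpoch x p n).
{ induction n as [|n IH].
  - now rewrite sum_O.
  - rewrite sum_Sn, IH. simpl.
    change (qpoch x p n + qpoch x p n * - (x * p ^ n)
            = qpoch x p n * (1 - x * p ^ n)).
    ring. }
set (K := exp (Cmod x / (1 - Cmod p))).
assert (Hex : @ex_series C_AbsRing C_NormedModule d).
{ apply (ex_series_incr_1 d).
  apply (@ex_series_le C_AbsRing C_CompleteNormedModule _
           (fun n => (K * Cmod x) * Cmod p ^ n)%R).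
  - intros n. change (Cmod (qpoch x p n * - (x * p ^ n))
                      <= K * Cmod x * Cmod p ^ n)%R.
    rewrite Cmod_mult, Cmod_opp, Cmod_mult, Cmod_pow, Rmult_assoc.
    apply Rmult_le_compat_r; [|exact (qpoch_bound x p n Hp)].
    apply Rmult_le_pos; [|apply pow_le]; apply Cmod_ge_0.
  - apply (ex_series_scal (K := R_AbsRing) (V := R_NormedModule) (K * Cmod x)%R).
    apply ex_series_geom. rewrite Rabs_pos_eq; [exact Hp|apply Cmod_ge_0]. }
destruct Hex as [l Hl].
assert (H : filterlim (qpoch x p) eventually (@locally C_NormedModule l))
  by exact (filterlim_ext _ _ Hsum Hl).
unfold qpoch_inf. rewrite (Clim_seq_unique _ _ H). exact H.
Qed.

(* Main.v *)
(* With p = q^2, A = q^2/a, B = q^2/b, x = ab, the sequences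
     alpha_r = (1-q)^2/(1-p) (1+q^(2r+1))/(1-q^(2r+1)) (-1)^r q^(r^2+r),
     beta_n = 1/(q^3;p)_n^2
   form a Bailey pair relative to p in base p.  Inserting
   beta_n = sum_r alpha_r / ((p;p)_(n-r) (q^4;p)_(n+r)) into the N-th finite form
   of Bailey's lemma, whose kernel is summed by the q-Pfaff-Saalschuetz formula,
   gives an identity between two finite sums; the theorem is its limit N -> oo,
   taken termwise by dominated convergence.  Both finite summations are proved by
   telescoping with a WZ certificate. *)
Require Import Defs.
From Stdlib Require Import Reals Lra Lia.
From Coquelicot Require Import Coquelicot.
Local Open Scope C_scope.

(** * Finite complex sums and q-shifted factorials *)

(** Fixing the group structure makes the rewriting lemmas produce the operations of [C] themselves,
    which [ring] and [field] recognise. *)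
Definition csum (u : nat -> C) (n : nat) : C := @sum_n C_AbelianGroup u n.

Lemma csum_0 (u : nat -> C) : csum u 0 = u O.
Proof. exact (sum_O u). Qed.

Lemma csum_S (u : nat -> C) (n : nat) : csum u (S n) = csum u n + u (S n).
Proof. exact (sum_Sn u n). Qed.

Lemma csum_ext_loc (u v : nat -> C) (n : nat) :
  (forall k, (k <= n)%nat -> u k = v k) -> csum u n = csum v n.
Proof. exact (sum_n_ext_loc u v n). Qed.

Lemma csum_plus (u v : nat -> C) (n : nat) :
  csum (fun k => u k + v k) n = csum u n + csum v n.
Proof. exact (sum_n_plus u v n). Qed.

Lemma csum_mult_l (c : C) (u : nat -> C) (n : nat) :
  csum (fun k => c * u k) n = c * csum u n.
Proof. exact (@sum_n_mult_l C_Ring c u n). Qed.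

Lemma csum_minus (u v : nat -> C) (n : nat) :
  csum (fun k => u k - v k) n = csum u n - csum v n.
Proof.
  induction n as [|n IH].
  - now rewrite !csum_0.
  - rewrite !csum_S, IH. ring.
Qed.

(** Passing from [N] to [N + 1] adds the term [n = N + 1] to every row [r <= N] and opens a new row
    [r = N + 1] with one term. With [k = n - r] as inner index, each row starts at zero, as the
    Saalschuetz sum requires. *)
Lemma csum_triangle (f : nat -> nat -> C) (N : nat) :
  csum (fun n => csum (f n) n) N
  = csum (fun r => csum (fun k => f (r + k)%nat r) (N - r)) N.
Proof.
  induction N as [|N IH].
  - now rewrite !csum_0.
  - rewrite csum_S, IH, (csum_S (f (S N))), (csum_S (fun r => csum _ _)), Nat.sub_diag.
    rewrite csum_0, Nat.add_0_r, Cplus_assoc. f_equal.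
    rewrite <- csum_plus. apply csum_ext_loc; intros r Hr.
    rewrite Nat.sub_succ_l, csum_S by exact Hr.
    now replace (r + S (N - r))%nat with (S N) by lia.
Qed.

Lemma qpoch_add (x p : C) (m n : nat) :
  qpoch x p (m + n) = qpoch x p m * qpoch (x * p ^ m) p n.
Proof.
  induction n as [|n IH].
  - rewrite Nat.add_0_r. simpl. ring.
  - rewrite Nat.add_succ_r. simpl. rewrite IH, Cpow_add_r. ring.
Qed.

Lemma Cpow_succ (z : C) (n : nat) : z ^ S n = z * z ^ n.
Proof. reflexivity. Qed.

Lemma qpoch_S (x p : C) (n : nat) : qpoch x p (S n) = qpoch x p n * (1 - x * p ^ n).
Proof. reflexivity. Qed.

(** Applied to [qpoch x p (S n) <> 0], it extracts the nonvanishing of the last factor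
    [1 - x * p ^ n]. *)
Lemma Cmult_neq0_r (x y : C) : x * y <> 0 -> y <> 0.
Proof. intros H E. apply H. rewrite E. ring. Qed.

(** * q-Pfaff-Saalschuetz summation *)

(** For nonzero [x] and [p] this is, up to the factor (x;p)_M/(p;p)_M, the k-th term of the balanced
    3phi2 with upper parameters A, B, p^(-M), lower parameters ABx, p^(1-M)/x, and argument p.
    Reversing two of the factors to the index [M - k] avoids negative powers. *)
Definition saalschutz_term (A B x p : C) (M k : nat) : C :=
  qpoch A p k * qpoch B p k * x ^ k * qpoch x p (M - k)
  / (qpoch p p (M - k) * qpoch p p k * qpoch (A * B * x) p k).

(* WZ certificate for the recurrence in [M] satisfied by the sum: the right-hand
   side has the form [G (S K)] with [G] vanishing at [0]. *)
Lemma saalschutz_telescope (A B x p : C) (K j : nat)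
  (hp : forall n, qpoch p p n <> 0) (hC : forall n, qpoch (A * B * x) p n <> 0) :
  let M := (K + j)%nat in
  csum (fun k => (1 - p ^ S M) * (1 - A * B * x * p ^ M) * saalschutz_term A B x p (S M) k
                 - (1 - A * x * p ^ M) * (1 - B * x * p ^ M) * saalschutz_term A B x p M k) K
  = - (p ^ j * qpoch A p (S K) * qpoch B p (S K) * x ^ S K * qpoch x p j
       / (qpoch p p j * qpoch p p K * qpoch (A * B * x) p K)).
Proof.
  (* Here [j] stands for [M - K]. It must vary in the induction: with [M] fixed, raising [K] lowers
     [j] by one. *)
  revert j; induction K as [|K IH]; intros j M.
  - assert (h1 := hp j). assert (h2 := Cmult_neq0_r _ _ (hp (S j))).
    unfold M. rewrite csum_0. unfold saalschutz_term. rewrite !Nat.sub_0_r. simpl Nat.add.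
    simpl qpoch. rewrite !Cpow_succ. simpl Cpow. field. now split.
  - rewrite csum_S. unfold M.
    replace (S K + j)%nat with (K + S j)%nat by lia. rewrite IH.
    unfold saalschutz_term.
    replace (S (K + S j) - S K)%nat with (S j) by lia.
    replace (K + S j - S K)%nat with j by lia.
    assert (h1 := hp j). assert (h2 := Cmult_neq0_r _ _ (hp (S j))).
    assert (h3 := hp K). assert (h4 := Cmult_neq0_r _ _ (hp (S K))).
    assert (h5 := hC K). assert (h6 := Cmult_neq0_r _ _ (hC (S K))).
    rewrite !qpoch_S. rewrite !Cpow_succ, Cpow_add_r, !Cpow_succ.
    field. repeat split; assumption.
Qed.

(* The lower parameter is [C = A B x], so that [A x] and [B x] are the usual
   [C / B] and [C / A]. *)
Lemma saalschutz (A B x p : C) (M : nat)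
  (hp : forall n, qpoch p p n <> 0) (hC : forall n, qpoch (A * B * x) p n <> 0) :
  csum (saalschutz_term A B x p M) M
  = qpoch (A * x) p M * qpoch (B * x) p M / (qpoch p p M * qpoch (A * B * x) p M).
Proof.
  induction M as [|M IH].
  - rewrite csum_0. unfold saalschutz_term. simpl. field.
  (* With [j = 0] the telescoped sum stops at [k = M]; the term [k = M + 1] of the larger sum is
     added separately by [csum_S]. *)
  - assert (T := saalschutz_telescope A B x p M 0 hp hC). cbv zeta in T.
    rewrite Nat.add_0_r, csum_minus, !csum_mult_l, IH in T.
    assert (h3 := hp M). assert (h4 := Cmult_neq0_r _ _ (hp (S M))).
    assert (h5 := hC M). assert (h6 := Cmult_neq0_r _ _ (hC (S M))).
    rewrite csum_S. unfold saalschutz_term at 2. rewrite Nat.sub_diag.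
    rewrite !qpoch_S in *. rewrite !Cpow_succ in *.
    change (csum (fun k => saalschutz_term A B x p (S M) k) M)
      with (csum (saalschutz_term A B x p (S M)) M) in T.
    set (s := csum (saalschutz_term A B x p (S M)) M) in *.
    assert (E : (1 - p * p ^ M) * (1 - A * B * x * p ^ M) <> 0) by now apply Cmult_neq_0.
    assert (Es : s = ((1 - p * p ^ M) * (1 - A * B * x * p ^ M) * s)
       / ((1 - p * p ^ M) * (1 - A * B * x * p ^ M))) by (field; now split).
    rewrite Es. clear Es.
    match type of T with ?u - ?v = ?w => assert (T' : u = w + v) by (rewrite <- T; ring) end.
    rewrite T'. simpl qpoch. simpl (p ^ 0). field. repeat split; assumption.
Qed.

(** * The Bailey pair *)

(* [Copp 1], since [- 1] in [C_scope] parses as the real literal [-1]. *)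
Definition bailey_alpha (q : C) (r : nat) : C :=
  (1 - q) ^ 2 / (1 - q ^ 2) * ((1 + q ^ (2 * r + 1)) / (1 - q ^ (2 * r + 1)))
  * (Copp 1) ^ r * q ^ (r ^ 2 + r).

(** The summand of the Bailey pair relation in base p = q^2 relative to p, whose second denominator
    has parameter p * p = q^4. *)
Definition bailey_term (q : C) (n r : nat) : C :=
  bailey_alpha q r / (qpoch (q ^ 2) (q ^ 2) (n - r) * qpoch (q ^ 4) (q ^ 2) (n + r)).

(** Together with [Cpow_sqr], it reduces every power to the atoms [q ^ m], so that the certificates
    become rational identities for [field]. *)
Lemma Cpow_double_add (q : C) (m k : nat) : q ^ (2 * m + k) = q ^ k * (q ^ m * q ^ m).
Proof. rewrite Cpow_add_r, Nat.mul_comm, Cpow_mult_r. simpl. ring. Qed.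

Lemma Cpow_sqr (q : C) (m : nat) : (q ^ 2) ^ m = q ^ m * q ^ m.
Proof. rewrite <- Cpow_mult_r, Nat.mul_comm, Cpow_mult_r. simpl. ring. Qed.

(* The summand is a multiple of [(1 - q^(2r+1))^2 * bailey_alpha q r], in which the
   denominator of [bailey_alpha] cancels; what is left telescopes. *)
Lemma bailey_pair_telescope (q : C) (R j : nat)
  (hodd : forall n, 1 - q ^ (2 * n + 1) <> 0)
  (h2 : forall n, qpoch (q ^ 2) (q ^ 2) n <> 0)
  (h4 : forall n, qpoch (q ^ 4) (q ^ 2) n <> 0) :
  let n := (R + j)%nat in
  csum (fun r => (1 - q ^ (2 * n + 3)) ^ 2 * bailey_term q (S n) r - bailey_term q n r) R
  = (1 - q) ^ 2 / (1 - q ^ 2) * (Copp 1) ^ R * q ^ (R ^ 2 + R) * q ^ (2 * n + 2)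
    * (1 - q ^ (2 * R + 2)) / (1 - q ^ (2 * n + 2))
    / (qpoch (q ^ 2) (q ^ 2) j * qpoch (q ^ 4) (q ^ 2) (S n + R)).
Proof.
  (* The nonvanishing facts are put in the shape to which the powers will be normalized, so that
     they match the side conditions of [field]. *)
  assert (n1 : forall m, 1 - q * (q ^ m * q ^ m) <> 0).
  { intros m. rewrite <- (Cpow_1_r q) at 1. rewrite <- Cpow_double_add. apply hodd. }
  assert (n2 : forall m, 1 - q ^ 2 * (q ^ m * q ^ m) <> 0).
  { intros m. rewrite <- Cpow_sqr. exact (Cmult_neq0_r _ _ (h2 (S m))). }
  assert (n4 : forall m, 1 - q ^ 4 * (q ^ m * q ^ m) <> 0).
  { intros m. rewrite <- Cpow_sqr. exact (Cmult_neq0_r _ _ (h4 (S m))). }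
  assert (n10 : 1 - q <> 0).
  { generalize (n1 O). simpl. now rewrite !Cmult_1_r. }
  assert (n20 : 1 - q ^ 2 <> 0).
  { generalize (n2 O). simpl. now rewrite !Cmult_1_r. }
  revert j; induction R as [|R IH]; intros j n.
  - rewrite csum_0. unfold bailey_term, bailey_alpha, n.
    rewrite !Nat.sub_0_r, !Nat.add_0_r, !Nat.add_0_l.
    assert (a1 := h2 j). assert (a2 := h4 j).
    assert (a3 := n2 j). assert (a4 := n4 j).
    rewrite !qpoch_S, !Cpow_sqr, !Cpow_double_add, ?Cpow_1_r.
    change (0 ^ 2 + 0)%nat with O. change (q ^ 0) with (RtoC 1) in *.
    change ((Copp 1) ^ 0) with (RtoC 1).
    field. repeat split; try assumption.
  - rewrite csum_S. unfold n. clear n.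
    replace (S R + j)%nat with (R + S j)%nat by lia. rewrite IH. clear IH.
    unfold bailey_term, bailey_alpha.
    replace (S (R + S j) - S R)%nat with (S j) by lia.
    replace (R + S j - S R)%nat with j by lia.
    replace (S (R + S j) + R)%nat with (S (R + R + S j)) by lia.
    replace (S (R + S j) + S R)%nat with (S (S (R + R + S j))) by lia.
    replace (R + S j + S R)%nat with (S (R + R + S j)) by lia.
    replace (S R ^ 2 + S R)%nat with ((R ^ 2 + R) + (R + R + 2))%nat by (simpl; lia).
    assert (a1 := h2 j). assert (a2 := h4 (R + R + S j)%nat).
    assert (a3 := n2 j). assert (a4 := n4 (R + R + S j)%nat).
    assert (a5 := n4 (S (R + R + S j)%nat)). assert (a6 := n1 (S R)).
    assert (a7 := n2 (R + S j)%nat).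
    rewrite !qpoch_S, !Cpow_sqr, !Cpow_double_add, ?Cpow_1_r.
    rewrite !(Cpow_add_r q), !(Cpow_succ _ R), !(Cpow_succ q j), (Cpow_succ q (R + R + S j)),
      !(Cpow_add_r q), !(Cpow_succ q j).
    rewrite (Cpow_succ q (R + R + S j)) in a5.
    rewrite !(Cpow_add_r q), !(Cpow_succ q j) in a4, a5.
    rewrite !(Cpow_add_r q), !(Cpow_succ q j) in a7. rewrite (Cpow_succ q R) in a6.
    (* Powers, shifted factorials and the sign are now independent atoms; what remains is a rational
       identity in them. *)
    set (u := q ^ R) in *. set (v := q ^ j) in *. set (w := q ^ (R ^ 2)).
    set (X := qpoch (q ^ 2) _ j) in *. set (Y := qpoch _ _ (R + R + S j)) in *.
    set (e := (Copp 1) ^ R).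
    field. repeat split; assumption.
Qed.

(** Induction on [n]: both sides satisfy the same first-order recurrence, the factor
    [1 - q ^ (2 * n + 3)] being the one that (q^3;q^2)_(n+1) gains over (q^3;q^2)_n. *)
Lemma bailey_pair (q : C) (n : nat)
  (hodd : forall n, 1 - q ^ (2 * n + 1) <> 0)
  (h2 : forall n, qpoch (q ^ 2) (q ^ 2) n <> 0)
  (h4 : forall n, qpoch (q ^ 4) (q ^ 2) n <> 0) :
  csum (bailey_term q n) n = / qpoch (q ^ 3) (q ^ 2) n ^ 2.
Proof.
  assert (n1 : forall m, 1 - q * (q ^ m * q ^ m) <> 0).
  { intros m. rewrite <- (Cpow_1_r q) at 1. rewrite <- Cpow_double_add. apply hodd. }
  assert (n3 : forall m, 1 - q ^ 3 * (q ^ m * q ^ m) <> 0).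
  { intros m. replace (q ^ 3 * (q ^ m * q ^ m)) with (q * (q ^ S m * q ^ S m)).
    - apply n1.
    - rewrite Cpow_succ. ring. }
  assert (n2 : forall m, 1 - q ^ 2 * (q ^ m * q ^ m) <> 0).
  { intros m. rewrite <- Cpow_sqr. exact (Cmult_neq0_r _ _ (h2 (S m))). }
  assert (n4 : forall m, 1 - q ^ 4 * (q ^ m * q ^ m) <> 0).
  { intros m. rewrite <- Cpow_sqr. exact (Cmult_neq0_r _ _ (h4 (S m))). }
  assert (n10 : 1 - q <> 0).
  { generalize (n1 O). simpl. now rewrite !Cmult_1_r. }
  assert (n20 : 1 - q ^ 2 <> 0).
  { generalize (n2 O). simpl. now rewrite !Cmult_1_r. }
  assert (h3 : forall m, qpoch (q ^ 3) (q ^ 2) m <> 0).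
  { induction m as [|m IH]; [exact C1_nz|].
    rewrite qpoch_S, Cpow_sqr. now apply Cmult_neq_0. }
  induction n as [|n IH].
  - rewrite csum_0. unfold bailey_term, bailey_alpha.
    change (0 - 0)%nat with O. change (0 + 0)%nat with O. change (2 * 0 + 1)%nat with 1%nat.
    change (0 ^ 2 + 0)%nat with O. rewrite Cpow_1_r. simpl qpoch.
    change (q ^ 0) with (RtoC 1). change ((Copp 1) ^ 0) with (RtoC 1).
    field. now split.
  (* As [j = 0] covers only [r <= n], the term [r = n + 1] is supplied by [csum_S]. *)
  - assert (T := bailey_pair_telescope q n 0 hodd h2 h4). cbv zeta in T.
    rewrite Nat.add_0_r, csum_minus, csum_mult_l in T.
    change (csum (fun r => bailey_term q n r) n) with (csum (bailey_term q n) n) in T.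
    rewrite IH in T. clear IH. rewrite csum_S.
    change (csum (fun r => bailey_term q (S n) r) n) with (csum (bailey_term q (S n)) n) in T.
    set (s := csum _ _) in *.
    assert (E : (1 - q ^ (2 * n + 3)) <> 0) by (rewrite Cpow_double_add; apply n3).
    assert (Es : s = (1 - q ^ (2 * n + 3)) ^ 2 * s / (1 - q ^ (2 * n + 3)) ^ 2) by now field.
    match type of T with ?u - ?v = ?w => assert (T' : u = w + v) by (rewrite <- T; ring) end.
    rewrite Es, T'. clear Es T T' s. unfold bailey_term, bailey_alpha. rewrite Nat.sub_diag.
    replace (S n + n)%nat with (S (n + n)) by lia.
    replace (S n + S n)%nat with (S (S (n + n))) by lia.
    replace (S n ^ 2 + S n)%nat with ((n ^ 2 + n) + (n + n + 2))%nat by (simpl; lia).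
    assert (a1 := h3 n). assert (a2 := h4 (n + n)%nat). assert (a3 := n2 n).
    assert (a4 := n4 (n + n)%nat). assert (a5 := n4 (S (n + n))). assert (a6 := n1 (S n)).
    rewrite !Cpow_double_add, Cpow_1_r in *. rewrite !qpoch_S, !Cpow_sqr.
    rewrite !(Cpow_add_r q), !(Cpow_succ _ n), (Cpow_succ q (n + n)), !(Cpow_add_r q).
    rewrite (Cpow_succ q (n + n)) in a5. rewrite !(Cpow_add_r q) in a4, a5.
    rewrite (Cpow_succ q n) in a6. assert (a7 := n3 n).
    simpl (qpoch _ _ 0).
    set (u := q ^ n) in *. set (w := q ^ (n ^ 2)).
    set (X := qpoch _ _ n) in *. set (Y := qpoch _ _ (n + n)) in *.
    set (e := (Copp 1) ^ n).
    field. repeat split; assumption.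
Qed.

Lemma qpoch_shift_neq0 (x p : C) : (forall n, qpoch x p n <> 0) ->
  forall m n, qpoch (x * p ^ m) p n <> 0.
Proof.
  intros H m n. apply (Cmult_neq0_r (qpoch x p m)). rewrite <- qpoch_add. apply H.
Qed.

(** * Finite Bailey transform *)

(** Expanding 1/(q^3;q^2)_n^2 by the Bailey pair and exchanging the sums leaves, for each [r], a
    Saalschuetz sum of length [N - r]. The condition on [A * B * x] makes its lower parameter agree
    with the factor (q^4;q^2)_(n+r) of the pair. *)
Lemma finite_bailey (q A B x : C) (N : nat) (hABx : A * B * x = q ^ 4)
  (hodd : forall n, 1 - q ^ (2 * n + 1) <> 0)
  (h2 : forall n, qpoch (q ^ 2) (q ^ 2) n <> 0)
  (h4 : forall n, qpoch (q ^ 4) (q ^ 2) n <> 0)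
  (hA : forall n, qpoch (A * x) (q ^ 2) n <> 0)
  (hB : forall n, qpoch (B * x) (q ^ 2) n <> 0) :
  csum (fun n => qpoch A (q ^ 2) n * qpoch B (q ^ 2) n * x ^ n
                 / qpoch (q ^ 3) (q ^ 2) n ^ 2
                 * (qpoch x (q ^ 2) (N - n) / qpoch (q ^ 2) (q ^ 2) (N - n))) N
  = csum (fun r => bailey_alpha q r * (qpoch A (q ^ 2) r * qpoch B (q ^ 2) r * x ^ r
                   / (qpoch (A * x) (q ^ 2) r * qpoch (B * x) (q ^ 2) r))
                   * (qpoch (A * x) (q ^ 2) N * qpoch (B * x) (q ^ 2) N
                      / (qpoch (q ^ 2) (q ^ 2) (N - r) * qpoch (q ^ 4) (q ^ 2) (N + r)))) N.
Proof.
  set (p := q ^ 2) in *.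
  rewrite (csum_ext_loc _ (fun n => csum (fun r =>
    qpoch A p n * qpoch B p n * x ^ n * (qpoch x p (N - n) / qpoch p p (N - n))
    * bailey_term q n r) n)).
  2:{ intros n _. rewrite csum_mult_l.
      change (fun r => bailey_term q n r) with (bailey_term q n).
      rewrite bailey_pair by assumption. fold p. unfold Cdiv. ring. }
  rewrite (csum_triangle (fun n r =>
    qpoch A p n * qpoch B p n * x ^ n * (qpoch x p (N - n) / qpoch p p (N - n))
    * bailey_term q n r)).
  apply csum_ext_loc; intros r Hr.
  (* Splitting off the first [r] factors shifts [A] and [B] by [p ^ r], hence the lower parameter by
     [p ^ (r + r)]; this is what remains of (q^4;p)_(2r+k) after its first 2r factors. *)
  assert (EC : A * p ^ r * (B * p ^ r) * x = q ^ 4 * p ^ (r + r)).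
  { rewrite <- hABx, Cpow_add_r. ring. }
  assert (HC : forall n, qpoch (A * p ^ r * (B * p ^ r) * x) p n <> 0).
  { rewrite EC. now apply qpoch_shift_neq0. }
  rewrite (csum_ext_loc _ (fun k =>
    bailey_alpha q r * (qpoch A p r * qpoch B p r * x ^ r / qpoch (q ^ 4) p (r + r))
    * saalschutz_term (A * p ^ r) (B * p ^ r) x p (N - r) k)).
  - rewrite csum_mult_l.
    change (fun k => saalschutz_term ?a ?b x p ?m k) with (saalschutz_term a b x p m).
    rewrite saalschutz by assumption.
    rewrite EC.
    assert (EA : qpoch (A * x) p N = qpoch (A * x) p r * qpoch (A * x * p ^ r) p (N - r)).
    { rewrite <- qpoch_add. f_equal. lia. }
    assert (EB : qpoch (B * x) p N = qpoch (B * x) p r * qpoch (B * x * p ^ r) p (N - r)).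
    { rewrite <- qpoch_add. f_equal. lia. }
    assert (E4 : qpoch (q ^ 4) p (N + r)
                 = qpoch (q ^ 4) p (r + r) * qpoch (q ^ 4 * p ^ (r + r)) p (N - r)).
    { rewrite <- qpoch_add. f_equal. lia. }
    rewrite EA, EB, E4.
    replace (A * p ^ r * x) with (A * x * p ^ r) by ring.
    replace (B * p ^ r * x) with (B * x * p ^ r) by ring.
    field. repeat split; auto using qpoch_shift_neq0.
  - intros k Hk. unfold saalschutz_term, bailey_term. fold p.
    replace (r + k - r)%nat with k by lia.
    replace (r + k + r)%nat with (r + r + k)%nat by lia.
    replace (N - (r + k))%nat with (N - r - k)%nat by lia.
    rewrite !qpoch_add, EC, Cpow_add_r.
    field. repeat split; auto using qpoch_shift_neq0.
Qed.

(** * Limits of complex sequences *)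

(** Stated through a real sequence, so that squeeze arguments and the limit laws for real sequences
    apply; [Clim_filterlim] links it to the filter form. *)
Definition Clim (u : nat -> C) (l : C) : Prop :=
  is_lim_seq (fun n => Cmod (u n - l)) 0.

Lemma Clim_filterlim (u : nat -> C) (l : C) :
  Clim u l <-> filterlim u eventually (@locally C_NormedModule l).
Proof.
  unfold Clim. rewrite <- is_lim_seq_spec.
  rewrite (@filterlim_locally_ball_norm C_AbsRing nat C_NormedModule eventually _ u l).
  split; intros H eps; specialize (H eps); revert H; apply filter_imp; intros n;
    change (ball_norm (V := C_NormedModule) l eps (u n)) with (Cmod (u n - l) < eps)%R;
    rewrite Rminus_0_r, Rabs_pos_eq by apply Cmod_ge_0; easy.
Qed.

Lemma Clim_unique (u : nat -> C) (l m : C) : Clim u l -> Clim u m -> l = m.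
Proof.
  intros Hl Hm. apply Clim_filterlim, Clim_seq_unique in Hl.
  apply Clim_filterlim, Clim_seq_unique in Hm. congruence.
Qed.

Lemma Clim_le (u : nat -> C) (l : C) (e : nat -> R) :
  (forall n, (Cmod (u n - l) <= e n)%R) -> is_lim_seq e 0 -> Clim u l.
Proof.
  intros H He. apply (is_lim_seq_le_le (fun _ => 0%R) _ e); [|apply is_lim_seq_const|exact He].
  intros n. split; [apply Cmod_ge_0|apply H].
Qed.

Lemma is_lim_seq_0_scal (e : nat -> R) (c : R) :
  is_lim_seq e 0 -> is_lim_seq (fun n => c * e n)%R 0.
Proof.
  intros H. replace 0%R with (c * 0)%R by ring. exact (is_lim_seq_scal_l e c 0 H).
Qed.

Lemma is_lim_seq_0_plus (e f : nat -> R) :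
  is_lim_seq e 0 -> is_lim_seq f 0 -> is_lim_seq (fun n => e n + f n)%R 0.
Proof.
  intros H1 H2. replace 0%R with (0 + 0)%R by ring. now apply is_lim_seq_plus'.
Qed.

(** The index type is arbitrary because dominated convergence needs bounds uniform over pairs
    [(N, n)] as well as over sequences. *)
Definition bounded {T : Type} (u : T -> C) : Prop :=
  exists K, forall i, (Cmod (u i) <= K)%R.

Lemma bounded_mult {T : Type} (u v : T -> C) :
  bounded u -> bounded v -> bounded (fun i => u i * v i).
Proof.
  intros [K HK] [L HL]. exists (K * L)%R. intros i. rewrite Cmod_mult.
  apply Rmult_le_compat; auto using Cmod_ge_0.
Qed.

Lemma bounded_comp {S T : Type} (f : S -> T) (u : T -> C) :
  bounded u -> bounded (fun i => u (f i)).
Proof. intros [K HK]. now exists K. Qed.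

Lemma bounded_const {T : Type} (c : C) : bounded (fun _ : T => c).
Proof. exists (Cmod c). intros _. apply Rle_refl. Qed.

Lemma Clim_bounded (u : nat -> C) (l : C) : Clim u l -> bounded u.
Proof.
  intros H. apply Clim_filterlim in H.
  destruct (@filterlim_bounded C_AbsRing C_NormedModule u (ex_intro _ l H)) as [K HK].
  now exists K.
Qed.

Lemma Clim_mult (u v : nat -> C) (l m : C) :
  Clim u l -> Clim v m -> Clim (fun n => u n * v n) (l * m).
Proof.
  intros Hu Hv. destruct (Clim_bounded u l Hu) as [K HK].
  apply (Clim_le _ _ (fun n => K * Cmod (v n - m) + Cmod m * Cmod (u n - l))%R).
  - intros n. replace (u n * v n - l * m) with (u n * (v n - m) + m * (u n - l)) by ring.
    eapply Rle_trans; [apply Cmod_triangle|]. rewrite !Cmod_mult.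
    apply Rplus_le_compat_r, Rmult_le_compat_r; [apply Cmod_ge_0|apply HK].
  - apply is_lim_seq_0_plus; now apply is_lim_seq_0_scal.
Qed.

Lemma Clim_plus (u v : nat -> C) (l m : C) :
  Clim u l -> Clim v m -> Clim (fun n => u n + v n) (l + m).
Proof.
  intros Hu Hv.
  apply (Clim_le _ _ (fun n => Cmod (u n - l) + Cmod (v n - m))%R).
  - intros n. replace (u n + v n - (l + m)) with ((u n - l) + (v n - m)) by ring.
    apply Cmod_triangle.
  - now apply is_lim_seq_0_plus.
Qed.

Lemma Clim_const (c : C) : Clim (fun _ => c) c.
Proof.
  apply (Clim_le _ _ (fun _ => 0%R)); [|apply is_lim_seq_const].
  intros _. replace (c - c) with (RtoC 0) by ring. rewrite Cmod_0. lra.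
Qed.

Lemma Clim_ext (u v : nat -> C) (l : C) :
  (forall n, u n = v n) -> Clim u l -> Clim v l.
Proof. intros E. apply is_lim_seq_ext. intros n. now rewrite E. Qed.

(** The uniform bound on the inverses gives 1 <= K |u_n|, which rules out a zero limit, and then
    controls 1/u_n - 1/l by |u_n - l|. *)
Lemma Clim_inv (u : nat -> C) (l : C) (K : R) :
  (forall n, u n <> 0) -> (forall n, (Cmod (/ u n) <= K)%R) -> Clim u l ->
  l <> 0 /\ Clim (fun n => / u n) (/ l).
Proof.
  intros Hu HK Hl.
  assert (HK0 : (0 <= K)%R) by (eapply Rle_trans; [apply Cmod_ge_0|apply (HK O)]).
  assert (Hl0 : l <> 0).
  { intros E. subst l.
    assert (H := is_lim_seq_0_scal _ K Hl).
    assert (H1 : (1 <= 0)%R).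
    { apply (is_lim_seq_le (fun _ => 1%R) (fun n => K * Cmod (u n - 0))%R 1 0);
        [|apply is_lim_seq_const|exact H].
      intros n. replace (u n - 0) with (u n) by ring.
      rewrite <- Cmod_1, <- (Cinv_l (u n) (Hu n)), Cmod_mult.
      apply Rmult_le_compat_r; [apply Cmod_ge_0|apply HK]. }
    lra. }
  split; [exact Hl0|].
  apply (Clim_le _ _ (fun n => (K * Cmod (/ l)) * Cmod (u n - l))%R).
  - intros n. specialize (Hu n).
    replace (/ u n - / l) with (/ u n * / l * - (u n - l)) by (field; now split).
    rewrite !Cmod_mult, Cmod_opp.
    apply Rmult_le_compat_r; [apply Cmod_ge_0|].
    apply Rmult_le_compat_r; [apply Cmod_ge_0|apply HK].
  - now apply is_lim_seq_0_scal.
Qed.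

Lemma Clim_incr_n (u : nat -> C) (k : nat) (l : C) :
  Clim u l <-> Clim (fun n => u (n + k)%nat) l.
Proof. exact (is_lim_seq_incr_n (fun n => Cmod (u n - l)) k 0). Qed.

Lemma Clim_minus_n (u : nat -> C) (k : nat) (l : C) :
  Clim u l -> Clim (fun n => u (n - k)%nat) l.
Proof.
  intros H. apply (Clim_incr_n _ k). revert H. apply Clim_ext. intros n.
  f_equal. lia.
Qed.

(** * Dominated convergence *)

(** The exact geometric difference is kept, since with the cruder bound by the infinite tail the
    induction on [N] would not close. *)
Lemma sum_geom_tail (d : nat -> R) (t L : R) (M N : nat) :
  (0 <= t < 1)%R -> (forall n, (d n <= L)%R) -> (M <= N)%nat ->
  (sum_n (fun n => t ^ n * d n) N
   <= sum_n (fun n => t ^ n * d n) M + L * (t ^ S M - t ^ S N) / (1 - t))%R.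
Proof.
  intros Ht Hd HM. induction HM as [|N HM IH].
  - unfold Rdiv. rewrite Rminus_diag, Rmult_0_r, Rmult_0_l, Rplus_0_r. apply Rle_refl.
  - rewrite sum_Sn. change plus with Rplus.
    assert (H := Rmult_le_compat_l (t ^ S N) _ _ (pow_le t (S N) (proj1 Ht))
      (Hd (S N))).
    replace (L * (t ^ S M - t ^ S (S N)) / (1 - t))%R
      with (L * (t ^ S M - t ^ S N) / (1 - t) + t ^ S N * L)%R
      by (simpl; field; lra).
    lra.
Qed.

Lemma sum_n_nonneg (u : nat -> R) (N : nat) :
  (forall n, (0 <= u n)%R) -> (0 <= sum_n u N)%R.
Proof.
  intros H. induction N as [|N IH].
  - rewrite sum_O. apply H.
  - rewrite sum_Sn. now apply Rplus_le_le_0_compat.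
Qed.

(** The sum is split at a fixed [M]: the head is a finite sum of null sequences, and the tail is at
    most L t^(M+1)/(1-t) uniformly in [N]. *)
Lemma tannery_null (d : nat -> nat -> R) (t L : R) :
  (0 <= t < 1)%R ->
  (forall N n, (0 <= d N n <= L)%R) ->
  (forall n, is_lim_seq (fun N => d N n) 0) ->
  is_lim_seq (fun N => sum_n (fun n => t ^ n * d N n)%R N) 0.
Proof.
  intros Ht Hd Hlim.
  assert (HL : (0 <= L)%R) by (destruct (Hd O O); lra).
  assert (Hfin : forall M, is_lim_seq (fun N => sum_n (fun n => t ^ n * d N n)%R M) 0).
  { induction M as [|M IH].
    - apply (is_lim_seq_ext (fun N => t ^ 0 * d N O)%R).
      + intros N. now rewrite sum_O.
      + now apply is_lim_seq_0_scal.
    - apply (is_lim_seq_ext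
        (fun N => sum_n (fun n => t ^ n * d N n) M + t ^ S M * d N (S M))%R).
      + intros N. now rewrite sum_Sn.
      + apply is_lim_seq_0_plus; [exact IH|now apply is_lim_seq_0_scal]. }
  apply is_lim_seq_spec. intros eps.
  assert (Hg : is_lim_seq (fun n => L / (1 - t) * t ^ n)%R 0).
  { apply is_lim_seq_0_scal, is_lim_seq_geom. rewrite Rabs_pos_eq; lra. }
  (* [M] is chosen to keep the tail below eps/2; [N0] then does the same for the head with this
     [M]. *)
  apply is_lim_seq_spec in Hg. destruct (Hg (pos_div_2 eps)) as [M HM].
  specialize (HM (S M) (le_S _ _ (le_n _))). simpl in HM.
  assert (H := Hfin M). apply is_lim_seq_spec in H. destruct (H (pos_div_2 eps)) as [N0 HN0].
  exists (max M N0). intros N HN.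
  specialize (HN0 N ltac:(lia)). simpl in HN0.
  assert (HT := sum_geom_tail (d N) t L M N Ht (fun n => proj2 (Hd N n)) ltac:(lia)).
  assert (Hpos : (0 <= sum_n (fun n => t ^ n * d N n) N)%R).
  { apply sum_n_nonneg. intros n. apply Rmult_le_pos; [now apply pow_le|now apply Hd]. }
  rewrite Rminus_0_r, Rabs_pos_eq by exact Hpos.
  rewrite Rminus_0_r in HN0, HM.
  apply Rabs_lt_between in HN0. apply Rabs_lt_between in HM.
  assert (HN1 : (0 <= t ^ S N)%R) by (apply pow_le; lra).
  assert (HT2 : (L * (t ^ S M - t ^ S N) / (1 - t) <= L / (1 - t) * t ^ S M)%R).
  { replace (L * (t ^ S M - t ^ S N) / (1 - t))%R
      with (L / (1 - t) * t ^ S M - L / (1 - t) * t ^ S N)%R by (field; lra).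
    assert (0 <= L / (1 - t) * t ^ S N)%R; [|lra].
    apply Rmult_le_pos; [|exact HN1]. apply Rdiv_le_0_compat; lra. }
  simpl in *. lra.
Qed.

Lemma csum_Cmod_le (u : nat -> C) (e : nat -> R) (N : nat) :
  (forall n, (Cmod (u n) <= e n)%R) -> (Cmod (csum u N) <= sum_n e N)%R.
Proof.
  intros H. induction N as [|N IH].
  - rewrite csum_0, sum_O. apply H.
  - rewrite csum_S, sum_Sn. eapply Rle_trans; [apply Cmod_triangle|].
    now apply Rplus_le_compat.
Qed.

(** Writing h = H + (h - H) separates [H] times the partial sums from a remainder handled by
    [tannery_null] with t = |x|. The weight may depend on the cutoff [N], as the factors with
    indices [N - n] and [N + n] do. *)
Lemma tannery (u : nat -> C) (x : C) (h : nat -> nat -> C) (G H : C) :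
  (Cmod x < 1)%R -> bounded u -> bounded (fun i => h (fst i) (snd i)) ->
  (forall n, Clim (fun N => h N n) H) ->
  Clim (csum (fun n => u n * x ^ n)) G ->
  Clim (fun N => csum (fun n => u n * x ^ n * h N n) N) (G * H).
Proof.
  intros Hx [K HK] [L HL] Hlim HG.
  apply (Clim_ext (fun N => csum (fun n => u n * x ^ n * (h N n - H)) N
                            + H * csum (fun n => u n * x ^ n) N)).
  { intros N. rewrite <- csum_mult_l, <- csum_plus. apply csum_ext_loc. intros n _. ring. }
  replace (G * H) with (0 + H * G) by ring.
  apply Clim_plus; [|apply Clim_mult; [apply Clim_const|exact HG]].
  apply (Clim_le _ _ (fun N => K * sum_n (fun n => Cmod x ^ n * Cmod (h N n - H)) N)%R).
  - intros N. unfold Cminus at 1. rewrite Copp_0, Cplus_0_r.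
    rewrite <- (sum_n_mult_l (K := R_Ring)). apply csum_Cmod_le. intros n.
    rewrite !Cmod_mult, Cmod_pow. change mult with Rmult. rewrite <- Rmult_assoc.
    apply Rmult_le_compat_r; [apply Cmod_ge_0|].
    apply Rmult_le_compat_r; [apply pow_le, Cmod_ge_0|apply HK].
  - apply is_lim_seq_0_scal, (tannery_null _ (Cmod x) (L + Cmod H)).
    + split; [apply Cmod_ge_0|exact Hx].
    + intros N n. split; [apply Cmod_ge_0|].
      unfold Cminus. eapply Rle_trans; [apply Cmod_triangle|].
      rewrite Cmod_opp. apply Rplus_le_compat_r. exact (HL (N, n)).
    + intros n. apply Hlim.
Qed.

Lemma ex_Cseries_bounded_geom (u : nat -> C) (x : C) :
  (Cmod x < 1)%R -> bounded u -> ex_Cseries (fun n => u n * x ^ n).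
Proof.
  intros Hx [K HK].
  apply (@ex_series_le C_AbsRing C_CompleteNormedModule _ (fun n => K * Cmod x ^ n)%R).
  - intros n. change (Cmod (u n * x ^ n) <= K * Cmod x ^ n)%R.
    rewrite Cmod_mult, Cmod_pow.
    apply Rmult_le_compat_r; [apply pow_le, Cmod_ge_0|apply HK].
  - apply (ex_series_scal (K := R_AbsRing) (V := R_NormedModule) K).
    apply ex_series_geom. rewrite Rabs_pos_eq; [exact Hx|apply Cmod_ge_0].
Qed.

Lemma Clim_CSeries (g : nat -> C) : ex_Cseries g -> Clim (csum g) (CSeries g).
Proof.
  intros [G HG]. rewrite (CSeries_unique _ _ HG). apply Clim_filterlim. exact HG.
Qed.

(** * Bounds for q-shifted factorials *)

Lemma one_minus_le_Cmod (z : C) : (1 - Cmod z <= Cmod (1 - z))%R.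
Proof.
  assert (H := Cmod_triangle (1 - z) z).
  replace (1 - z + z) with (RtoC 1) in H by ring. rewrite Cmod_1 in H. lra.
Qed.

Lemma one_minus_neq0 (z : C) : (Cmod z < 1)%R -> 1 - z <> 0.
Proof.
  intros Hz E. assert (H := one_minus_le_Cmod z). rewrite E, Cmod_0 in H. lra.
Qed.

Lemma Cmod_mult_pow_le (x p : C) (n : nat) :
  (Cmod p <= 1)%R -> (Cmod (x * p ^ n) <= Cmod x)%R.
Proof.
  intros Hp. rewrite Cmod_mult, Cmod_pow.
  rewrite <- (Rmult_1_r (Cmod x)) at 2. apply Rmult_le_compat_l; [apply Cmod_ge_0|].
  rewrite <- (pow1 n). apply pow_incr. split; [apply Cmod_ge_0|exact Hp].
Qed.

Lemma qpoch_neq0 (x p : C) (n : nat) :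
  (Cmod x < 1)%R -> (Cmod p < 1)%R -> qpoch x p n <> 0.
Proof.
  intros Hx Hp. induction n as [|n IH]; [exact C1_nz|].
  apply Cmult_neq_0; [exact IH|]. apply one_minus_neq0.
  eapply Rle_lt_trans; [apply Cmod_mult_pow_le; lra|exact Hx].
Qed.

Lemma exp_le_exp (u v : R) : (u <= v)%R -> (exp u <= exp v)%R.
Proof. intros [H| ->]; [left; now apply exp_increasing|apply Rle_refl]. Qed.

(** Each inverse factor is at most 1/(1-z) = 1 + z/(1-z) with z = |x p^n|, hence at most exp(c
    |p|^n) with c = |x|/(1-|x|); the exponents form a geometric series. *)
Lemma qpoch_inv_bound (x p : C) (n : nat) :
  (Cmod x < 1)%R -> (Cmod p < 1)%R ->
  (Cmod (/ qpoch x p n) <= exp (Cmod x / (1 - Cmod x) / (1 - Cmod p)))%R.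
Proof.
  intros Hx Hp. assert (Hx0 := Cmod_ge_0 x). assert (Hp0 := Cmod_ge_0 p).
  set (c := (Cmod x / (1 - Cmod x))%R).
  assert (Hc : (0 <= c)%R) by (apply Rdiv_le_0_compat; lra).
  (* The induction carries the partial geometric sum in the exponent; it is replaced by the full sum
     only afterwards. *)
  assert (H : (Cmod (/ qpoch x p n) <= exp (c * ((1 - Cmod p ^ n) / (1 - Cmod p))))%R).
  { induction n as [|n IH].
    - simpl. replace (/ 1) with (RtoC 1) by field. rewrite Cmod_1.
      replace (c * ((1 - 1) / (1 - Cmod p)))%R with 0%R by (field; lra).
      rewrite exp_0; lra.
    - rewrite qpoch_S.
      assert (Hle := Cmod_mult_pow_le x p n (Rlt_le _ _ Hp)).
      assert (n1 := qpoch_neq0 x p n Hx Hp).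
      assert (n2 : 1 - x * p ^ n <> 0) by (apply one_minus_neq0; lra).
      replace (/ (qpoch x p n * (1 - x * p ^ n)))
        with (/ qpoch x p n * / (1 - x * p ^ n)) by (field; now split).
      replace (c * ((1 - Cmod p ^ S n) / (1 - Cmod p)))%R
        with (c * ((1 - Cmod p ^ n) / (1 - Cmod p)) + c * Cmod p ^ n)%R
        by (simpl; field; lra).
      rewrite Cmod_mult, exp_plus.
      apply Rmult_le_compat; try apply Cmod_ge_0; [exact IH|].
      eapply Rle_trans; [|apply exp_ineq1_le].
      rewrite Cmod_inv by exact n2.
      assert (Hz := one_minus_le_Cmod (x * p ^ n)).
      assert (E : (c * Cmod p ^ n = Cmod (x * p ^ n) / (1 - Cmod x))%R).
      { unfold c. rewrite Cmod_mult, Cmod_pow. field. lra. }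
      rewrite E. set (z := Cmod (x * p ^ n)) in *.
      assert (Hz0 : (0 <= z)%R) by apply Cmod_ge_0.
      apply Rle_trans with (/ (1 - z))%R.
      + apply Rinv_le_contravar; lra.
      + replace (/ (1 - z))%R with (1 + z / (1 - z))%R by (field; lra).
        apply Rplus_le_compat_l, Rmult_le_compat_l; [exact Hz0|].
        apply Rinv_le_contravar; lra. }
  eapply Rle_trans; [exact H|]. apply exp_le_exp.
  apply Rmult_le_compat_l; [exact Hc|].
  rewrite <- (Rmult_1_l (/ (1 - Cmod p))).
  apply Rmult_le_compat_r; [left; apply Rinv_0_lt_compat; lra|].
  assert (0 <= Cmod p ^ n)%R by now apply pow_le. lra.
Qed.

Lemma qpoch_lim (x p : C) : (Cmod p < 1)%R -> Clim (qpoch x p) (qpoch_inf x p).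
Proof. intros Hp. apply Clim_filterlim. now apply qpoch_inf_correct. Qed.

Lemma qpoch_inv_lim (x p : C) : (Cmod x < 1)%R -> (Cmod p < 1)%R ->
  qpoch_inf x p <> 0 /\ Clim (fun n => / qpoch x p n) (/ qpoch_inf x p).
Proof.
  intros Hx Hp.
  apply (Clim_inv _ _ (exp (Cmod x / (1 - Cmod x) / (1 - Cmod p)))).
  - intros n. now apply qpoch_neq0.
  - intros n. now apply qpoch_inv_bound.
  - now apply qpoch_lim.
Qed.

Lemma bounded_qpoch (x p : C) : (Cmod p < 1)%R -> bounded (qpoch x p).
Proof. intros Hp. eexists. intros n. now apply qpoch_bound. Qed.

Lemma bounded_qpoch_inv (x p : C) : (Cmod x < 1)%R -> (Cmod p < 1)%R ->
  bounded (fun n => / qpoch x p n).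
Proof. intros Hx Hp. eexists. intros n. now apply qpoch_inv_bound. Qed.

Lemma Cmod_pow_lt_1 (z : C) (n : nat) : (Cmod z < 1)%R -> (Cmod (z ^ S n) < 1)%R.
Proof.
  intros Hz. eapply Rle_lt_trans; [|exact Hz]. apply Cmod_mult_pow_le. now left.
Qed.

Lemma Cmod_pow_le_1 (z : C) (n : nat) : (Cmod z < 1)%R -> (Cmod (z ^ n) <= 1)%R.
Proof.
  intros Hz. destruct n as [|n].
  - change (z ^ 0) with (RtoC 1). rewrite Cmod_1. apply Rle_refl.
  - left. now apply Cmod_pow_lt_1.
Qed.

Lemma bounded_odd_power_ratio (q : C) : (Cmod q < 1)%R ->
  bounded (fun n => (1 + q ^ (2 * n + 1)) / (1 - q ^ (2 * n + 1))).
Proof.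
  intros Hq. exists (2 * / (1 - Cmod q))%R. intros n.
  assert (Hle : (Cmod (q ^ (2 * n + 1)) <= Cmod q)%R).
  { rewrite Nat.add_1_r. apply Cmod_mult_pow_le. now left. }
  set (z := q ^ (2 * n + 1)) in *.
  unfold Cdiv. rewrite Cmod_mult, Cmod_inv by (apply one_minus_neq0; lra).
  assert (H1 := one_minus_le_Cmod z). assert (H2 := Cmod_triangle 1 z).
  rewrite Cmod_1 in H2.
  apply Rmult_le_compat; [apply Cmod_ge_0| |lra|].
  - left. apply Rinv_0_lt_compat. lra.
  - apply Rinv_le_contravar; lra.
Qed.

(** * Passage to the limit in the finite identity *)

Theorem theorem4p2 (q a b : C)
  (hq0 : q <> 0) (ha0 : a <> 0) (hb0 : b <> 0)
  (hq : (Cmod q < 1)%R)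
  (hmax : (Rmax (Cmod (a * b)) (Rmax (Cmod (a * q ^ 2)) (Cmod (b * q ^ 2))) < 1)%R) :
  let rhs_term := fun n : nat =>
    (1 + q ^ (2 * n + 1)) / (1 - q ^ (2 * n + 1))
    * ((qpoch (q ^ 2 / a) (q ^ 2) n * qpoch (q ^ 2 / b) (q ^ 2) n)
       / (qpoch (a * q ^ 2) (q ^ 2) n * qpoch (b * q ^ 2) (q ^ 2) n))
    * (- (a * b)) ^ n * q ^ (n ^ 2 + n) in
  ex_Cseries (phi32_term (q ^ 2 / a) (q ^ 2 / b) (q ^ 2) (q ^ 3) (q ^ 3)
                (q ^ 2) (a * b))
  /\ ex_Cseries rhs_term
  /\ (qpoch_inf (q ^ 2) (q ^ 2) * qpoch_inf (a * b) (q ^ 2))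
     / (qpoch_inf (a * q ^ 2) (q ^ 2) * qpoch_inf (b * q ^ 2) (q ^ 2))
     * phi32 (q ^ 2 / a) (q ^ 2 / b) (q ^ 2) (q ^ 3) (q ^ 3) (q ^ 2) (a * b)
     = (1 - q) ^ 2 * CSeries rhs_term.
Proof.
  assert (hx : (Cmod (a * b) < 1)%R).
  { eapply Rle_lt_trans; [apply Rmax_l|exact hmax]. }
  assert (hmax' := Rle_lt_trans _ _ _ (Rmax_r _ _) hmax).
  assert (ha : (Cmod (a * q ^ 2) < 1)%R).
  { eapply Rle_lt_trans; [apply Rmax_l|exact hmax']. }
  assert (hb : (Cmod (b * q ^ 2) < 1)%R).
  { eapply Rle_lt_trans; [apply Rmax_r|exact hmax']. }
  clear hmax hmax'.
  assert (hp := Cmod_pow_lt_1 q 1 hq). assert (hq3 := Cmod_pow_lt_1 q 2 hq).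
  assert (hq4 := Cmod_pow_lt_1 q 3 hq).
  assert (hodd : forall n, 1 - q ^ (2 * n + 1) <> 0).
  { intros n. apply one_minus_neq0. rewrite Nat.add_1_r. now apply Cmod_pow_lt_1. }
  assert (h1q := one_minus_neq0 q hq). assert (h1p := one_minus_neq0 _ hp).
  set (A := q ^ 2 / a). set (B := q ^ 2 / b).
  (* The roles cross over: [A x] is the denominator parameter containing [b], and [B x] the one
     containing [a]. *)
  assert (EA : A * (a * b) = b * q ^ 2) by (unfold A; field; exact ha0).
  assert (EB : B * (a * b) = a * q ^ 2) by (unfold B; field; exact hb0).
  assert (EC : A * B * (a * b) = q ^ 4) by (unfold A, B; field; now split).
  intros rhs.
  set (p := q ^ 2) in *. set (x := a * b) in *.
  set (phi := phi32_term A B p (q ^ 3) (q ^ 3) p x).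
  (* The third upper parameter of the 3phi2 equals the base, so its factor cancels (p;p)_n. Inverses
     are written separately to fit the boundedness lemmas. *)
  set (u := fun n => qpoch A p n * qpoch B p n * (/ qpoch (q ^ 3) p n * / qpoch (q ^ 3) p n)).
  (* Only [(- x) ^ n] serves as the geometric majorant; the factor [q ^ (n ^ 2 + n)] is merely
     bounded by 1 and stays in the coefficient. *)
  set (v := fun n => (1 + q ^ (2 * n + 1)) / (1 - q ^ (2 * n + 1))
    * (qpoch A p n * qpoch B p n * (/ qpoch (a * p) p n * / qpoch (b * p) p n))
    * q ^ (n ^ 2 + n)).
  assert (Hphi : forall n, u n * x ^ n = phi n).
  { intros n. unfold phi, phi32_term, u. field.
    split; now apply qpoch_neq0. }
  assert (Hrhs : forall n, v n * (- x) ^ n = rhs n).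
  { intros n. unfold rhs, v. field. repeat split; try apply hodd; now apply qpoch_neq0. }
  assert (hx' : (Cmod (- x) < 1)%R) by now rewrite Cmod_opp.
  assert (bu : bounded u).
  { unfold u. repeat apply bounded_mult; auto using bounded_qpoch, bounded_qpoch_inv. }
  assert (bv : bounded v).
  { unfold v. apply bounded_mult; [apply bounded_mult; [now apply bounded_odd_power_ratio|]|].
    { repeat apply bounded_mult; auto using bounded_qpoch, bounded_qpoch_inv. }
    exists 1%R. intros n. now apply Cmod_pow_le_1. }
  assert (sphi : ex_Cseries phi).
  { apply (ex_series_ext _ _ Hphi). now apply ex_Cseries_bounded_geom. }
  assert (srhs : ex_Cseries rhs).
  { apply (ex_series_ext _ _ Hrhs). now apply ex_Cseries_bounded_geom. }
  split; [exact sphi|]. split; [exact srhs|].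
  destruct (qpoch_inv_lim p p hp hp) as [np lp].
  destruct (qpoch_inv_lim (q ^ 4) p hq4 hp) as [n4 l4].
  destruct (qpoch_inv_lim (a * p) p ha hp) as [na _].
  destruct (qpoch_inv_lim (b * p) p hb hp) as [nb _].
  (* The constant prefactor of [bailey_alpha], moved into the weight of the right-hand sum. *)
  set (kappa := (1 - q) ^ 2 / (1 - p)).
  assert (L1 : Clim (fun N => csum (fun n => u n * x ^ n
      * (qpoch x p (N - n) * / qpoch p p (N - n))) N)
      (CSeries phi * (qpoch_inf x p * / qpoch_inf p p))).
  { apply (tannery u x (fun N n => qpoch x p (N - n) * / qpoch p p (N - n))).
    - exact hx.
    - exact bu.
    - apply (bounded_comp (fun i => (fst i - snd i)%nat)
        (fun m => qpoch x p m * / qpoch p p m)).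
      apply bounded_mult; auto using bounded_qpoch, bounded_qpoch_inv.
    - intros n. apply (Clim_minus_n (fun m => qpoch x p m * / qpoch p p m)).
      apply Clim_mult; [now apply qpoch_lim|exact lp].
    - apply (Clim_ext (csum phi)); [|now apply Clim_CSeries].
      intros N. apply csum_ext_loc. intros n _. now rewrite Hphi. }
  assert (L2 : Clim (fun N => csum (fun n => v n * (- x) ^ n
      * (kappa * (qpoch (a * p) p N * qpoch (b * p) p N
         * (/ qpoch p p (N - n) * / qpoch (q ^ 4) p (N + n))))) N)
      (CSeries rhs * (kappa * (qpoch_inf (a * p) p * qpoch_inf (b * p) p
         * (/ qpoch_inf p p * / qpoch_inf (q ^ 4) p))))).
  { apply (tannery v (- x) (fun N n => kappa * (qpoch (a * p) p N * qpoch (b * p) p N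
         * (/ qpoch p p (N - n) * / qpoch (q ^ 4) p (N + n))))).
    - exact hx'.
    - exact bv.
    - apply bounded_mult; [apply bounded_const|]. repeat apply bounded_mult.
      + apply (bounded_comp fst (qpoch (a * p) p)). now apply bounded_qpoch.
      + apply (bounded_comp fst (qpoch (b * p) p)). now apply bounded_qpoch.
      + apply (bounded_comp (fun i => (fst i - snd i)%nat) (fun m => / qpoch p p m)).
        now apply bounded_qpoch_inv.
      + apply (bounded_comp (fun i => (fst i + snd i)%nat) (fun m => / qpoch (q ^ 4) p m)).
        now apply bounded_qpoch_inv.
    - intros n. apply Clim_mult; [apply Clim_const|].
      repeat apply Clim_mult; try now apply qpoch_lim.
      + now apply (Clim_minus_n (fun m => / qpoch p p m)).
      + now apply (Clim_incr_n (fun m => / qpoch (q ^ 4) p m) n).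
    - apply (Clim_ext (csum rhs)); [|now apply Clim_CSeries].
      intros N. apply csum_ext_loc. intros n _. now rewrite Hrhs. }
  (* By [finite_bailey] the sequences in [L1] and [L2] coincide for every [N], so their limits are
     equal. *)
  assert (E : CSeries phi * (qpoch_inf x p * / qpoch_inf p p)
    = CSeries rhs * (kappa * (qpoch_inf (a * p) p * qpoch_inf (b * p) p
         * (/ qpoch_inf p p * / qpoch_inf (q ^ 4) p)))).
  { apply (Clim_unique _ _ _ L1). revert L2. apply Clim_ext. intros N.
    assert (T := finite_bailey q A B x N EC hodd (fun n => qpoch_neq0 _ _ n hp hp)
      (fun n => qpoch_neq0 _ _ n hq4 hp)). fold p in T. rewrite EA, EB in T.
    specialize (T (fun n => qpoch_neq0 _ _ n hb hp) (fun n => qpoch_neq0 _ _ n ha hp)).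
    transitivity (csum (fun n => qpoch A p n * qpoch B p n * x ^ n / qpoch (q ^ 3) p n ^ 2
      * (qpoch x p (N - n) / qpoch p p (N - n))) N).
    - rewrite T. apply csum_ext_loc. intros n _. unfold v, bailey_alpha, kappa. fold p.
      replace (- x) with (Copp 1 * x) by ring. rewrite Cpow_mult_l.
      field. repeat split; try apply hodd; try now apply qpoch_neq0.
      exact h1p.
    - apply csum_ext_loc. intros n _. unfold u. field.
      repeat split; now apply qpoch_neq0. }
  (* Detaching the first factor of (p;p)_oo gives 1 - p, which cancels the denominator of [kappa]
     and leaves [(1 - q) ^ 2]. *)
  assert (Ep : qpoch_inf p p = (1 - p) * qpoch_inf (q ^ 4) p).
  { apply (Clim_unique (fun n => qpoch p p (n + 1))).
    - apply (Clim_incr_n (qpoch p p)). now apply qpoch_lim.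
    - apply (Clim_ext (fun n => (1 - p) * qpoch (q ^ 4) p n)).
      + intros n. rewrite Nat.add_comm, qpoch_add. simpl (qpoch p p 1).
        replace (p * p ^ 1) with (q ^ 4) by (unfold p; ring). ring.
      + apply Clim_mult; [apply Clim_const|now apply qpoch_lim]. }
  change (phi32 A B p (q ^ 3) (q ^ 3) p x) with (CSeries phi).
  assert (E' : CSeries phi * qpoch_inf x p
    = CSeries rhs * (kappa * (qpoch_inf (a * p) p * qpoch_inf (b * p) p)
        * / qpoch_inf (q ^ 4) p)).
  { transitivity (CSeries phi * (qpoch_inf x p * / qpoch_inf p p) * qpoch_inf p p).
    - field. exact np.
    - rewrite E. field. now split. }
  transitivity (CSeries phi * qpoch_inf x p * qpoch_inf p p
    / (qpoch_inf (a * p) p * qpoch_inf (b * p) p)).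
  - field. now split.
  - rewrite E', Ep. unfold kappa. field. repeat split; assumption.
Qed.
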